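(* Let $m,n\ge r\ge1$, let $L:\mathbb{R}^{m\times n}\to\mathbb{R}$ be differentiable and let $\lambda>0$. For $A\in\mathbb{R}^{m\times r}$, $B\in\mathbb{R}^{n\times r}$ let $\mathcal{L}_{L2}(A,B)=L(AB^\top)+\frac{\lambda}{2}\left(\|A\|_F^2+\|B\|_F^2\right)$, and for $W\in\mathbb{R}^{m\times n}$ let $\mathcal{L}_*(W)=L(W)+\lambda\|W\|_*$. Then $(A,B)$ is a local minimum of $\mathcal{L}_{L2}$ if and only if (1) $W=AB^\top$ is a local minimum of $\mathcal{L}_*$ restricted to the set of $m\times n$ matrices of rank at most $r$ (the maximal rank achievable by a product $AB^\top$ of such factors), and (2) $A^\top A=B^\top B$.
   Context: $\|\cdot\|_F$ is the Frobenius norm and $\|W\|_*=\operatorname{Tr}(\sqrt{WW^\top})$ is the nuclear norm (sum of singular values). A local minimum of $\mathcal{L}_*$ restricted to a set $\mathcal{M}$ means a point $W\in\mathcal{M}$ such that $\mathcal{L}_*(W')\ge\mathcal{L}_*(W)$ for all $W'\in\mathcal{M}$ in a neighbourhood of $W$. *)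

(* Defs.v *)
From HB Require Import structures.
From mathcomp Require Import all_boot all_order all_algebra.
From mathcomp Require Import all_classical all_reals all_analysis.
Set Implicit Arguments. Unset Strict Implicit. Unset Printing Implicit Defensive.
Import Order.TTheory GRing.Theory Num.Theory.
Import numFieldNormedType.Exports.
Local Open Scope classical_set_scope.
Local Open Scope ring_scope.

Definition frob_sq (R : realType) (p q : nat) (A : 'M[R]_(p, q)) : R :=
  \sum_(i < p) \sum_(j < q) A i j ^+ 2.

Definition psd (R : realType) (p : nat) (S : 'M[R]_p) : Prop :=
  S^T = S /\ forall v : 'rV[R]_p, 0 <= (v *m S *m v^T) 0 0.

Definition psd_sqrt (R : realType) (p : nat) (M : 'M[R]_p) : 'M[R]_p :=
  xget 0 [set S : 'M[R]_p | psd S /\ S *m S = M].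

Definition nuclear_norm (R : realType) (m n : nat) (W : 'M[R]_(m, n)) : R :=
  \tr (psd_sqrt (W *m W^T)).

Definition loss_L2 (R : realType) (m n r : nat) (L : 'M[R]_(m, n) -> R)
  (lambda : R) (AB : 'M[R]_(m, r) * 'M[R]_(n, r)) : R :=
  L (AB.1 *m AB.2^T) + lambda / 2 * (frob_sq AB.1 + frob_sq AB.2).

Definition loss_nuc (R : realType) (m n : nat) (L : 'M[R]_(m, n) -> R)
  (lambda : R) (W : 'M[R]_(m, n)) : R :=
  L W + lambda * nuclear_norm W.

Definition local_min_on {T : topologicalType} {R : realType}
  (f : T -> R) (M : set T) (x : T) : Prop :=
  M x /\ \forall y \near x, M y -> f x <= f y.

Definition local_min {T : topologicalType} {R : realType}
  (f : T -> R) (x : T) : Prop := local_min_on f setT x.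

Definition rank_le (R : realType) (m n r : nat) : set 'M[R]_(m, n) :=
  [set W | (\rank W <= r)%N].

(* Main.v *)
Require Import Defs.
From HB Require Import structures.
From mathcomp Require Import all_boot all_order all_algebra.
From mathcomp Require Import all_classical all_reals all_analysis.
From mathcomp Require Import ring lra.
Import Order.TTheory GRing.Theory Num.Theory.
Import numFieldNormedType.Exports.
Local Open Scope classical_set_scope.
Local Open Scope ring_scope.

(* Rescaling [(A *m G, B *m G^-1)] along one direction leaves [A *m B^T] fixed,
   so at a local minimum of [loss_L2], and likewise at a factorization of
   minimal Frobenius cost, the factors are balanced: [A^T *m A = B^T *m B].  For
   balanced factors [A *m A^T] is the positive square root of [W *m W^T], where
   [W = A *m B^T], so the cost [(|A|^2 + |B|^2) / 2] equals the nuclear norm.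
   Since a factorization of minimal cost exists by compactness, the nuclear norm
   is the minimal cost, which gives the backward implication.  Balanced
   factorizations of a given [W] agree up to a common rotation, which [loss_L2]
   does not see; a compactness argument then provides, for [W'] near [W],
   balanced factors near [(A, B)] up to rotation, whence the forward one. *)

(** * Frobenius norm and uniqueness of positive semidefinite square roots *)

Lemma frob_sq_tr {R : realType} {p q : nat} (A : 'M[R]_(p, q)) :
  frob_sq A = \tr (A *m A^T).
Proof.
apply: eq_bigr => i _; rewrite mxE; apply: eq_bigr => j _.
by rewrite mxE expr2.
Qed.

Lemma frob_sq_ge0 {R : realType} {p q : nat} (A : 'M[R]_(p, q)) :
  0 <= frob_sq A.
Proof. by apply: sumr_ge0 => i _; apply: sumr_ge0 => j _; rewrite sqr_ge0. Qed.

Lemma sqr_entry_le_frob_sq {R : realType} {p q : nat} (A : 'M[R]_(p, q)) i j :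
  A i j ^+ 2 <= frob_sq A.
Proof.
rewrite /frob_sq (bigD1 i)//= (bigD1 j)//= -addrA lerDl addr_ge0//.
  by apply: sumr_ge0 => ? _; rewrite sqr_ge0.
by apply: sumr_ge0 => ? _; apply: sumr_ge0 => ? _; rewrite sqr_ge0.
Qed.

Lemma frob_sq_eq0 {R : realType} {p q : nat} (A : 'M[R]_(p, q)) :
  frob_sq A = 0 -> A = 0.
Proof.
move=> A0; apply/matrixP => i j; rewrite mxE; apply/eqP.
by rewrite -sqrf_eq0 eq_le sqr_ge0 -A0 sqr_entry_le_frob_sq.
Qed.

Lemma mulmx_tr_frob_sq {R : realType} {q : nat} (v : 'rV[R]_q) :
  v *m v^T = (frob_sq v)%:M.
Proof. by rewrite [LHS]mx11_scalar frob_sq_tr trace_mx11. Qed.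

(** Moving from [x] by [t] in the direction [y = x *m S] gives the form [2 t |y|^2 + t^2 c], which
    is negative for small negative [t] unless [y = 0]. *)
Lemma psd_form_eq0 {R : realType} {p : nat} (S : 'M[R]_p) (x : 'rV[R]_p) :
  psd S -> (x *m S *m x^T) 0 0 = 0 -> x *m S = 0.
Proof.
move=> [Ssym Spos] x0; apply: frob_sq_eq0; set y := x *m S.
set b := frob_sq y; set c : R := (y *m S *m y^T) 0 0.
have b0 : 0 <= b by exact: frob_sq_ge0.
have c0 : 0 <= c by exact: Spos.
have form t : ((x + t *: y) *m S *m (x + t *: y)^T) 0 0 = t *+ 2 * b + t ^+ 2 * c.
  rewrite linearD linearZ/= !mulmxDl !mulmxDr -!scalemxAl -!scalemxAr scalerA.
  have addE (M N : 'M[R]_1) : (M + N) 0 0 = M 0 0 + N 0 0 by rewrite mxE.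
  have scaleE k (M : 'M[R]_1) : (k *: M) 0 0 = k * M 0 0 by rewrite mxE.
  rewrite !addE !scaleE x0 -/c.
  have -> : (x *m S *m y^T) 0 0 = b by rewrite -/y mulmx_tr_frob_sq mxE.
  have -> : (y *m S *m x^T) 0 0 = b.
    by rewrite -mulmxA -{1}Ssym -trmx_mul -/y mulmx_tr_frob_sq mxE eqxx.
  ring.
(* The minimizer would be [t = - b / c]; the [+ 1] keeps the denominator positive when [c = 0]. *)
have := Spos (x - (b / (c + 1)) *: y).
rewrite -scaleNr form => h.
have c1 : 0 < c + 1 by lra.
suff : b ^+ 2 <= 0.
  by move=> h2; apply/eqP; rewrite -sqrf_eq0 eq_le h2 sqr_ge0.
have e : (- (b / (c + 1)) *+ 2 * b + (- (b / (c + 1))) ^+ 2 * c) * (c + 1) ^+ 2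
   = - (b ^+ 2 * (c + 2)) by field; rewrite gt_eqF.
have : 0 <= - (b ^+ 2 * (c + 2)) by rewrite -e mulr_ge0// sqr_ge0.
by have := sqr_ge0 b; clear -c0; nra.
Qed.

(** Put [D = S - T]. The forms of [S] and [T] at the rows of [D] are nonnegative with total zero, so
    each vanishes; then [D *m S = D *m T = 0], whence [D *m D = 0]. *)
Lemma psd_sqrt_uniq {R : realType} {p : nat} (S T : 'M[R]_p) :
  psd S -> psd T -> S *m S = T *m T -> S = T.
Proof.
move=> pS pT ST; pose D := S - T.
have DT : D^T = D by rewrite /D linearB/= pS.1 pT.1.
have formE (X : 'M[R]_p) :
    \tr (D *m X *m D) = \sum_i (row i D *m X *m (row i D)^T) 0 0.
  rewrite /mxtrace; apply: eq_bigr => i _; rewrite tr_row DT -!row_mul.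
  by rewrite !mxE; apply: eq_bigr => j _; rewrite [col _ _ _ _]mxE.
(* [(S - T) *m (S + T) *m (S - T)] has trace zero because [S *m S = T *m T]. *)
have sum0 : \tr (D *m S *m D) + \tr (D *m T *m D) = 0.
  rewrite -linearD/= -mulmxDl -mulmxDr.
  have -> : D *m (S + T) = S *m T - T *m S.
    by rewrite mulmxBl !mulmxDr ST; rewrite opprD addrACA addrC subrKA.
  have STS : \tr (S *m T *m S) = \tr (T *m S *m S) by rewrite -mulmxA mxtrace_mulC.
  have TST : \tr (T *m S *m T) = \tr (S *m T *m T) by rewrite -mulmxA mxtrace_mulC.
  by rewrite /D mulmxBl !mulmxBr !linearB/= STS TST; ring.
have row0 i : (row i D *m S *m (row i D)^T) 0 0 = 0 /\
    (row i D *m T *m (row i D)^T) 0 0 = 0.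
  have := sum0; rewrite !formE -big_split/= => /eqP.
  rewrite psumr_eq0 => [/allP/(_ i)|j _]; last first.
    by rewrite addr_ge0//; [exact: pS.2|exact: pT.2].
  rewrite mem_index_enum => /(_ isT); rewrite paddr_eq0; [|exact: pS.2|exact: pT.2].
  by case/andP => /eqP-> /eqP->.
have DD : D *m D^T = 0.
  rewrite DT {2}/D; apply/row_matrixP => i; rewrite matrix.row0 row_mul mulmxBr.
  by rewrite (psd_form_eq0 _ _ pS (row0 i).1) (psd_form_eq0 _ _ pT (row0 i).2) subrr.
apply/eqP; rewrite -subr_eq0; apply/eqP/frob_sq_eq0.
by rewrite frob_sq_tr DD mxtrace0.
Qed.

Lemma psd_gram {R : realType} {p q : nat} (A : 'M[R]_(p, q)) : psd (A *m A^T).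
Proof.
split=> [|v]; first by rewrite trmx_mul trmxK.
by rewrite mulmxA -mulmxA -trmx_mul mulmx_tr_frob_sq mxE eqxx frob_sq_ge0.
Qed.

Lemma psd_sqrtE {R : realType} {p : nat} (M S : 'M[R]_p) :
  psd S -> S *m S = M -> psd_sqrt M = S.
Proof.
(* [S] itself witnesses that the set is nonempty, so [xget] does not return its default [0]. *)
move=> pS SM; have [pT TM] := @xgetPex _ 0 [set S : 'M[R]_p | psd S /\ S *m S = M]
  (ex_intro _ S (conj pS SM)).
by apply: psd_sqrt_uniq => //; rewrite SM.
Qed.

(** * Nuclear norm of a product of balanced factors *)

Lemma balanced_gram_sqr {R : realType} {m n r : nat}
  (A : 'M[R]_(m, r)) (B : 'M[R]_(n, r)) :
  A^T *m A = B^T *m B ->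
  (A *m A^T) *m (A *m A^T) = (A *m B^T) *m (A *m B^T)^T.
Proof.
move=> AB; rewrite trmx_mul trmxK -!mulmxA; congr (_ *m _).
by rewrite !mulmxA AB.
Qed.

Lemma nuclear_norm_balanced {R : realType} {m n r : nat}
  (A : 'M[R]_(m, r)) (B : 'M[R]_(n, r)) :
  A^T *m A = B^T *m B ->
  nuclear_norm (A *m B^T) = (frob_sq A + frob_sq B) / 2.
Proof.
move=> AB; rewrite /nuclear_norm (psd_sqrtE _ (A *m A^T) (psd_gram _)); last first.
  exact: balanced_gram_sqr.
have -> : frob_sq B = frob_sq A by rewrite !frob_sq_tr mxtrace_mulC -AB mxtrace_mulC.
by rewrite -frob_sq_tr; field.
Qed.

(** * Reflections and matrices with equal Gram matrices *)

Lemma householder {R : realType} {q : nat} (u : 'rV[R]_q) :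
  let H := 1%:M - (2 / frob_sq u) *: (u^T *m u) in
  [/\ H^T = H, H *m H = 1%:M &
   forall z : 'rV[R]_q, z *m H = z - (2 / frob_sq u * (z *m u^T) 0 0) *: u].
Proof.
move=> H; have HT : H^T = H.
  by rewrite /H linearB linearZ/= trmx1 trmx_mul trmxK.
have zH (z : 'rV[R]_q) : z *m H = z - (2 / frob_sq u * (z *m u^T) 0 0) *: u.
  rewrite /H mulmxBr mulmx1 -scalemxAr mulmxA.
  by rewrite [z *m u^T in LHS]mx11_scalar mul_scalar_mx scalerA.
split=> //.
(* For [u = 0] the matrix [H] is the identity; otherwise it is the reflection negating [u], and
   [u *m H = - u] yields [H *m H = 1]. *)
have [/frob_sq_eq0 u0|s0] := eqVneq (frob_sq u) 0.
  by rewrite /H u0 mulmx0 scaler0 subr0 mulmx1.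
have uH : u *m H = - u.
  rewrite zH mulmx_tr_frob_sq mxE eqxx mulr1n mulrVK ?unitfE//.
  by rewrite scaler_nat mulr2n opprD addNKr.
rewrite {1}/H mulmxBl mul1mx -scalemxAl -mulmxA uH mulmxN scalerN opprK.
by rewrite /H subrK.
Qed.

Lemma gram_eq_orthogonal {R : realType} {p q : nat} (Z Y : 'M[R]_(p, q)) :
  Z *m Z^T = Y *m Y^T -> exists2 Q : 'M[R]_q, Q *m Q^T = 1%:M & Y = Z *m Q.
Proof.
move=> ZY; suff /(_ p)[Q QQ rows] : forall k, exists2 Q : 'M[R]_q, Q *m Q^T = 1%:M &
    forall i : 'I_p, (i < k)%N -> row i (Z *m Q) = row i Y.
  by exists Q => //; apply/row_matrixP => i; rewrite rows.
(* The reflection exchanging the [k]-th rows of [Z *m Q] and [Y] fixes the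
   rows already matched, since these have equal inner products with both. *)
elim=> [|k [Q QQ rows]].
  by exists 1%:M => [|//]; rewrite trmx1 mulmx1.
have [kp|pk] := ltnP k p; last first.
  by exists Q => // i _; apply: rows; exact: leq_trans pk.
pose i0 := Ordinal kp; pose Z1 := Z *m Q.
have Z1Y : Z1 *m Z1^T = Y *m Y^T.
  by rewrite /Z1 trmx_mul mulmxA -(mulmxA Z) QQ mulmx1.
pose f (x y : 'rV[R]_q) : R := (x *m y^T) 0 0.
have fC x y : f x y = f y x.
  by rewrite /f !mxE; apply: eq_bigr => j _; rewrite !mxE mulrC.
have fB x y z : f x (y - z) = f x y - f x z.
  by rewrite /f linearB/= mulmxBr !mxE.
have inner i j : f (row i Z1) (row j Z1) = f (row i Y) (row j Y).
  have e (M : 'M[R]_(p, q)) : f (row i M) (row j M) = (M *m M^T) i j.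
    by rewrite /f !mxE; apply: eq_bigr => l _; rewrite !mxE.
  by rewrite !e Z1Y.
pose u := row i0 Z1 - row i0 Y.
have [HT HH zH] := householder u.
set H := (X in X^T = X) in HT HH zH.
exists (Q *m H); first by rewrite trmx_mul mulmxA -(mulmxA Q) HT HH mulmx1.
move=> i; rewrite ltnS leq_eqVlt mulmxA row_mul zH => /predU1P[ik|ik].
  have -> : i = i0 by exact: val_inj.
  have [u0|s0] := eqVneq (frob_sq u) 0.
    move/frob_sq_eq0: u0 => u0; rewrite u0 scaler0 subr0.
    by apply/eqP; rewrite -subr_eq0; apply/eqP.
  (* The two rows have equal norms, so the reflection subtracts exactly [u] from the first and lands
     on the second. *)
  have uu : frob_sq u = 2 * f (row i0 Z1) u.
    have -> : frob_sq u = f u u by rewrite /f mulmx_tr_frob_sq mxE eqxx.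
    rewrite {2}/u fB !(fC u) !fB inner (fC (row i0 Y) (row i0 Z1)); ring.
  rewrite -/(f _ _) mulrAC -uu divff// scale1r.
  by rewrite /u opprB addrC subrK.
rewrite -/(f _ _) -/Z1 (_ : f _ _ = 0); first by rewrite mulr0 scale0r subr0 rows.
by rewrite fB inner rows// subrr.
Qed.

(** * Rescaling along one direction and the balance condition *)

(** For [v] nonzero, this scales the line of [v] by [c] and fixes its orthogonal complement; for
    [v = 0] it is the identity. *)
Definition stretch {R : realType} {q : nat} (v : 'rV[R]_q) (c : R) : 'M[R]_q :=
  1%:M + ((c - 1) / frob_sq v) *: (v^T *m v).

Lemma stretch_tr {R : realType} {q : nat} (v : 'rV[R]_q) (c : R) :
  (stretch v c)^T = stretch v c.
Proof. by rewrite /stretch linearD linearZ/= trmx1 trmx_mul trmxK. Qed.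

Lemma stretchM {R : realType} {q : nat} (v : 'rV[R]_q) (c d : R) :
  stretch v c *m stretch v d = stretch v (c * d).
Proof.
rewrite /stretch; have [/frob_sq_eq0->|s0] := eqVneq (frob_sq v) 0.
  by rewrite mulmx0 !scaler0 !addr0 mulmx1.
rewrite mulmxDl mul1mx mulmxDr mulmx1 -addrA; congr (_ + _).
rewrite -scalemxAl -scalemxAr mulmxA -(mulmxA v^T) mulmx_tr_frob_sq.
rewrite mul_mx_scalar -scalemxAl !scalerA -!scalerDl; congr (_ *: _).
by field.
Qed.

Lemma stretch1 {R : realType} {q : nat} (v : 'rV[R]_q) : stretch v 1 = 1%:M.
Proof. by rewrite /stretch subrr mul0r scale0r addr0. Qed.

Lemma frob_sq_stretch {R : realType} {p q : nat} (A : 'M[R]_(p, q)) v c :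
  frob_sq (A *m stretch v c) =
  frob_sq A + (c ^+ 2 - 1) / frob_sq v * frob_sq (A *m v^T).
Proof.
rewrite 2!frob_sq_tr (frob_sq_tr (_ *m v^T)) trmx_mul stretch_tr.
rewrite mulmxA -(mulmxA A) stretchM /stretch mulmxDr mulmx1 mulmxDl linearD/= -scalemxAr -scalemxAl.
by rewrite linearZ/= trmx_mul trmxK !mulmxA expr2.
Qed.

Lemma near_right_ex {R : realType} (x : R) (P : set R) :
  nbhs x P -> exists2 y, x < y & P y.
Proof.
move=> xP; near x^'+ => y; exists y; near: y; first exact: nbhs_right_gt.
exact: (@cvg_within _ _ _ _ P xP).
Unshelve. all: by end_near.
Qed.

Lemma near_left_ex {R : realType} (x : R) (P : set R) :
  nbhs x P -> exists2 y, y < x & P y.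
Proof.
move=> xP; near x^'- => y; exists y; near: y; first exact: nbhs_left_lt.
exact: (@cvg_within _ _ _ _ P xP).
Unshelve. all: by end_near.
Qed.

(** With [a = |A v^T|^2] and [b = |B v^T|^2], the change of cost has the sign of
    [(c^2 - 1) (c^2 a - b)]. The first factor changes sign at [c = 1], so [a = b] for every [v], and
    the quadratic form of [A^T *m A - B^T *m B] vanishes. *)
Lemma balanced_of_stretch {R : realType} {m n r : nat}
  (A : 'M[R]_(m, r)) (B : 'M[R]_(n, r)) :
  (forall v : 'rV[R]_r, \forall c \near (1 : R),
    frob_sq A + frob_sq B <=
    frob_sq (A *m stretch v c) + frob_sq (B *m stretch v c^-1)) ->
  A^T *m A = B^T *m B.
Proof.
move=> AB.
have norms (v : 'rV[R]_r) : frob_sq (A *m v^T) = frob_sq (B *m v^T).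
  have [/frob_sq_eq0->|s0] := eqVneq (frob_sq v) 0.
    rewrite trmx0 !mulmx0 /frob_sq !big1// => i _;
      by rewrite big1// => j _; rewrite mxE expr0n.
  set a := frob_sq (A *m v^T); set b := frob_sq (B *m v^T).
  have sv : 0 < frob_sq v by rewrite lt_neqAle eq_sym s0 frob_sq_ge0.
  have prod : \forall c \near (1 : R), 0 <= (c ^+ 2 - 1) * (c ^+ 2 * a - b).
    have := AB v; apply: filterS2 (lt_nbhsr ltr01) => c c0.
    rewrite !frob_sq_stretch -/a -/b => h.
    have -> : (c ^+ 2 - 1) * (c ^+ 2 * a - b) = c ^+ 2 * frob_sq v *
       ((c ^+ 2 - 1) / frob_sq v * a + (c^-1 ^+ 2 - 1) / frob_sq v * b).
      by field; rewrite s0 gt_eqF.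
    by apply: mulr_ge0; [rewrite mulr_ge0 ?sqr_ge0 ?ltW | lra].
  have cont : (fun c : R => c ^+ 2 * a - b) @ (1 : R) --> 1 ^+ 2 * a - b.
    apply: cvgB; last exact: cvg_cst.
    by apply: cvgM; [exact: exprn_continuous|exact: cvg_cst].
  rewrite expr1n mul1r in cont.
  (* Near [1] the second factor keeps the sign of [a - b], so a contradiction comes from [c > 1] if
     [a < b] and from [c < 1] if [b < a]. *)
  case: (ltgtP a b) => // ab.
  - have neg : \forall c \near (1 : R), c ^+ 2 * a - b < 0.
      by apply: (cvgr_lt _ cont); rewrite subr_lt0.
    have [c c1 [h1 h2]] := near_right_ex _ _ (filterI prod neg).
    have c2 : 0 < c ^+ 2 - 1 by nra.
    by move: h1; rewrite pmulr_rge0// leNgt h2.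
  - have pos : \forall c \near (1 : R), 0 < c ^+ 2 * a - b.
      by apply: (cvgr_gt _ cont); rewrite subr_gt0.
    have [c c1 [c0 [h1 h2]]] := near_left_ex _ _
      (filterI (lt_nbhsr ltr01) (filterI prod pos)).
    have c2 : c ^+ 2 - 1 < 0 by nra.
    by move: h1; rewrite pmulr_lge0// leNgt c2.
have quad (v : 'rV[R]_r) : (v *m (A^T *m A - B^T *m B) *m v^T) 0 0 = 0.
  have e p (C : 'M[R]_(p, r)) : (v *m (C^T *m C) *m v^T) 0 0 = frob_sq (C *m v^T).
    by rewrite frob_sq_tr mxtrace_mulC trmx_mul trmxK !mulmxA trace_mx11.
  have -> : v *m (A^T *m A - B^T *m B) *m v^T =
      v *m (A^T *m A) *m v^T - v *m (B^T *m B) *m v^T.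
    by rewrite mulmxBr mulmxBl.
  have subE (M N : 'M[R]_1) : (M - N) 0 0 = M 0 0 - N 0 0 by rewrite !mxE.
  by rewrite subE !e norms subrr.
(* A symmetric matrix whose form is identically zero is in particular positive semidefinite, so
   [psd_form_eq0] kills each of its rows. *)
have pD : psd (A^T *m A - B^T *m B).
  by split=> [|v]; [rewrite linearB/= !trmx_mul !trmxK | rewrite quad].
apply/eqP; rewrite -subr_eq0; apply/eqP/row_matrixP => i.
by rewrite rowE (psd_form_eq0 _ _ pD (quad _)) matrix.row0.
Qed.

(** * Entrywise convergence, compact boxes and closed conditions *)

Lemma cvg_mx {T : Type} {F : set_system T} {FF : Filter F} {R : realType}
  {m n : nat} (f : T -> 'M[R]_(m, n)) (M : 'M[R]_(m, n)) :
  (forall i j, f x i j @[x --> F] --> M i j) -> f x @[x --> F] --> M.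
Proof.
move=> fM V [P MP PV]; rewrite /nbhs/=.
have : \forall x \near F, forall i j, P i j (f x i j).
  by apply: filter_forall => i; apply: filter_forall => j; exact: fM (MP i j).
by apply: filterS => x Px; exact: PV.
Qed.

Lemma cvg_mx_coord {T : Type} {F : set_system T} {FF : Filter F} {R : realType}
  {m n : nat} (f : T -> 'M[R]_(m, n)) (M : 'M[R]_(m, n)) i j :
  f x @[x --> F] --> M -> f x i j @[x --> F] --> M i j.
Proof.
move=> fM.
exact: (cvg_comp f (fun A : 'M[R]_(m, n) => A i j) fM (@coord_continuous R m n i j M)).
Qed.

Lemma cvg_mulmx {T : Type} {F : set_system T} {FF : Filter F} {R : realType}
  {m n p : nat} (f : T -> 'M[R]_(m, n)) (g : T -> 'M[R]_(n, p))
  (M : 'M[R]_(m, n)) (N : 'M[R]_(n, p)) :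
  f x @[x --> F] --> M -> g x @[x --> F] --> N ->
  f x *m g x @[x --> F] --> M *m N.
Proof.
move=> fM gN; apply: cvg_mx => i j; rewrite mxE.
under eq_cvg do rewrite mxE.
apply: cvg_big => [|k _]; first exact: add_continuous.
by apply: cvgM; exact: cvg_mx_coord.
Qed.

Lemma cvg_trmx {T : Type} {F : set_system T} {FF : Filter F} {R : realType}
  {m n : nat} (f : T -> 'M[R]_(m, n)) (M : 'M[R]_(m, n)) :
  f x @[x --> F] --> M -> (f x)^T @[x --> F] --> M^T.
Proof.
move=> fM; apply: cvg_mx => i j; rewrite mxE.
by under eq_cvg do rewrite mxE; exact: cvg_mx_coord.
Qed.

Lemma cvg_frob_sq {T : Type} {F : set_system T} {FF : Filter F} {R : realType}
  {m n : nat} (f : T -> 'M[R]_(m, n)) (M : 'M[R]_(m, n)) :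
  f x @[x --> F] --> M -> frob_sq (f x) @[x --> F] --> frob_sq M.
Proof.
move=> fM; apply: cvg_big => [|i _]; first exact: add_continuous.
apply: cvg_big => [|j _]; first exact: add_continuous.
rewrite expr2; under eq_cvg do rewrite expr2.
by apply: cvgM; exact: cvg_mx_coord.
Qed.

Lemma continuous_mul_tr {R : realType} {m n r : nat} :
  continuous (fun P : 'M[R]_(m, r) * 'M[R]_(n, r) => P.1 *m P.2^T).
Proof.
move=> P; apply: cvg_mulmx; first exact: cvg_fst.
by apply: cvg_trmx; exact: cvg_snd.
Qed.

Definition mx_box {R : realType} (m n : nat) (c : R) : set 'M[R]_(m, n) :=
  [set A | forall i j, `|A i j| <= c].

Lemma mx_box_compact {R : realType} (m n : nat) (c : R) : compact (mx_box m n c).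
Proof.
(* Flattening matrices to row vectors turns the box into a product of segments, to which
   [rV_compact] applies. *)
have -> : mx_box m n c =
    vec_mx @` [set v : 'rV[R]_(m * n) | forall i, `[- c, c]%classic (v ord0 i)].
  apply/seteqP; split=> [A Ac|_ [v vc <-] i j].
    exists (mxvec A); last exact: mxvecK.
    by move=> k; case/mxvec_indexP: k => i j; rewrite mxvecE /= in_itv/= -ler_norml.
  by rewrite mxE; have := vc (mxvec_index i j); rewrite /= in_itv/= -ler_norml.
apply: continuous_compact; last first.
  by apply: (@rV_compact R _ (fun=> `[- c, c]%classic)) => i; exact: segment_compact.
apply: continuous_subspaceT => v.
apply: (@cvg_mx _ (nbhs v) (nbhs_filter v)) => i j; rewrite mxE.
by under eq_cvg do rewrite mxE; exact: coord_continuous.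
Qed.

Lemma mx_box_pair_compact {R : realType} (m n r : nat) (c : R) :
  compact (mx_box m r c `*` mx_box n r c).
Proof. by apply: compact_setX; exact: mx_box_compact. Qed.

Lemma rank_le_factor {R : realType} {m n r : nat} (W : 'M[R]_(m, n)) :
  (\rank W <= r)%N ->
  exists (A : 'M[R]_(m, r)) (B : 'M[R]_(n, r)), A *m B^T = W.
Proof.
(* A full-rank factorization has inner dimension [\rank W]; [pid_mx] pads it with zeros up to
   [r]. *)
move=> Wr; exists (col_base W *m pid_mx (\rank W)).
exists ((pid_mx (\rank W) : 'M[R]_(r, \rank W)) *m row_base W)^T.
rewrite trmxK mulmxA -(mulmxA (col_base W)) pid_mx_id// pid_mx_1 mulmx1.
exact: mulmx_base.
Qed.

Lemma closed_mx_eq {R : realType} {m n : nat} {T : topologicalType}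
  (f : T -> 'M[R]_(m, n)) (M : 'M[R]_(m, n)) :
  continuous f -> closed [set x | f x = M].
Proof.
move=> cf; apply: (preimage_closed (f := f) (D := [set M])).
  by move=> x _; exact: cf.
by apply: accessible_closed_set1; apply: hausdorff_accessible; exact: norm_hausdorff.
Qed.

(** * Factorizations of minimal cost and the nuclear norm *)

Lemma balanced_of_min_factor {R : realType} {m n r : nat}
  (A : 'M[R]_(m, r)) (B : 'M[R]_(n, r)) :
  (forall (A' : 'M[R]_(m, r)) (B' : 'M[R]_(n, r)), A' *m B'^T = A *m B^T ->
    frob_sq A + frob_sq B <= frob_sq A' + frob_sq B') ->
  A^T *m A = B^T *m B.
Proof.
move=> minAB; apply: balanced_of_stretch => v.
apply: filterS (lt_nbhsr (ltr01 : 0 < 1 :> R)) => c c0; apply: minAB.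
rewrite trmx_mul stretch_tr mulmxA -(mulmxA A) stretchM divff ?gt_eqF//.
by rewrite stretch1 mulmx1.
Qed.

Lemma exists_min_factor {R : realType} {m n r : nat} (W : 'M[R]_(m, n)) :
  (\rank W <= r)%N ->
  exists (A : 'M[R]_(m, r)) (B : 'M[R]_(n, r)), A *m B^T = W /\
    forall (A' : 'M[R]_(m, r)) (B' : 'M[R]_(n, r)), A' *m B'^T = W ->
    frob_sq A + frob_sq B <= frob_sq A' + frob_sq B'.
Proof.
move=> /rank_le_factor[A0 [B0 W0]].
(* The [1 +] turns the bound [x^2 <= c - 1] on an entry into [|x| <= c]. *)
pose c := 1 + (frob_sq A0 + frob_sq B0).
pose g (P : 'M[R]_(m, r) * 'M[R]_(n, r)) := frob_sq P.1 + frob_sq P.2.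
pose K := (mx_box m r c `*` mx_box n r c) `&` [set P | P.1 *m P.2^T = W].
have Kg P : P.1 *m P.2^T = W -> g P <= g (A0, B0) -> K P.
  move=> PW gP; have entry p q (M : 'M[R]_(p, q)) :
      frob_sq M <= g (A0, B0) -> mx_box p q c M.
    move=> Mg i j; have := sqr_entry_le_frob_sq M i j; rewrite -real_normK ?num_real//.
    have := frob_sq_ge0 A0; have := frob_sq_ge0 B0; have := normr_ge0 (M i j).
    by move: Mg; rewrite /c /g/=; nra.
  have := frob_sq_ge0 P.1; have := frob_sq_ge0 P.2; move: gP; rewrite {1}/g => gP h1 h2.
  by split=> //; split; apply: entry; lra.
have cK : compact K.
  apply: compact_closedI; first exact: mx_box_pair_compact.
  by apply: closed_mx_eq; exact: continuous_mul_tr.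
have K0 : K !=set0 by exists (A0, B0); exact: Kg.
have cg : {within K, continuous g}.
  apply: continuous_subspaceT => P.
  by apply: cvgD; apply: cvg_frob_sq; [exact: cvg_fst | exact: cvg_snd].
have [P PK minP] := compact_EVT_min K0 cK cg.
move: PK; rewrite inE => -[_ PW]; exists P.1, P.2; split=> // A' B' AB'.
(* A factorization costlier than [(A0, B0)] may lie outside [K], but [(A0, B0)] is in [K] and
   already costs at least the minimum. *)
have [gle|glt] := leP (g (A', B')) (g (A0, B0)).
  by apply: (minP (A', B')); rewrite inE; exact: Kg.
by apply/(le_trans _ (ltW glt))/minP; rewrite inE; exact: Kg.
Qed.

Lemma nuclear_norm_le {R : realType} {m n r : nat}
  (A : 'M[R]_(m, r)) (B : 'M[R]_(n, r)) :
  nuclear_norm (A *m B^T) <= (frob_sq A + frob_sq B) / 2.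
Proof.
have [A' [B' [AB' minAB']]] := exists_min_factor (A *m B^T) (mulmx_max_rank A B^T).
rewrite -AB' nuclear_norm_balanced; last first.
  by apply: balanced_of_min_factor => A1 B1; rewrite AB'; exact: minAB'.
by rewrite ler_pM2r ?invr_gt0 ?ltr0n//; exact: minAB'.
Qed.

(** * Balanced factors of a given product: rotations and bounds *)

Lemma balanced_factor_orthogonal {R : realType} {m n r : nat}
  (A A' : 'M[R]_(m, r)) (B B' : 'M[R]_(n, r)) :
  A^T *m A = B^T *m B -> A'^T *m A' = B'^T *m B' -> A *m B^T = A' *m B'^T ->
  exists2 Q : 'M[R]_r, Q *m Q^T = 1%:M & A' = A *m Q /\ B' = B *m Q.
Proof.
move=> AB AB' e.
have eT : B *m A^T = B' *m A'^T by rewrite -[LHS]trmxK trmx_mul trmxK e trmx_mul trmxK.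
(* Both sides are positive semidefinite square roots of the same [W *m W^T]; likewise below with
   [W^T *m W]. *)
have AA : A *m A^T = A' *m A'^T.
  apply: psd_sqrt_uniq; [exact: psd_gram|exact: psd_gram|].
  by rewrite (balanced_gram_sqr _ _ AB) (balanced_gram_sqr _ _ AB') e.
have BB : B *m B^T = B' *m B'^T.
  apply: psd_sqrt_uniq; [exact: psd_gram|exact: psd_gram|].
  by rewrite (balanced_gram_sqr B A) ?(balanced_gram_sqr B' A') ?eT.
(* Stacking the factors makes one [Q] serve both: the blocks of the stacked Gram matrix are
   [A *m A^T], [B *m B^T], [W] and [W^T]. *)
have [|Q QQ] := gram_eq_orthogonal (col_mx A B) (col_mx A' B').
  by rewrite !tr_col_mx !mul_col_row AA BB e eT.
by rewrite mul_col_mx => /eq_col_mx[-> ->]; exists Q.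
Qed.

Lemma frob_sq_trmx {R : realType} {m n : nat} (A : 'M[R]_(m, n)) :
  frob_sq A^T = frob_sq A.
Proof. by rewrite !frob_sq_tr trmxK mxtrace_mulC. Qed.

(** By balance [A *m A^T] has the Frobenius norm of the product, and its [i]-th diagonal entry is at
    least [A i j ^+ 2]. Thus balanced factors of bounded products stay bounded. *)
Lemma balanced_entry_le {R : realType} {m n r : nat}
  (A : 'M[R]_(m, r)) (B : 'M[R]_(n, r)) i j :
  A^T *m A = B^T *m B -> (A i j ^+ 2) ^+ 2 <= frob_sq (A *m B^T).
Proof.
move=> AB; rewrite frob_sq_tr -(balanced_gram_sqr _ _ AB).
have {2}<- : (A *m A^T)^T = A *m A^T by rewrite trmx_mul trmxK.
rewrite -frob_sq_tr; apply: le_trans (sqr_entry_le_frob_sq _ i i).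
rewrite ler_pXn2r ?nnegrE ?sqr_ge0//.
  rewrite mxE (bigD1 j)//= mxE -expr2 lerDl sumr_ge0// => k _.
  by rewrite mxE -expr2 sqr_ge0.
by rewrite mxE sumr_ge0// => k _; rewrite mxE -expr2 sqr_ge0.
Qed.

Lemma balanced_mx_box {R : realType} {m n r : nat}
  (A : 'M[R]_(m, r)) (B : 'M[R]_(n, r)) (c : R) :
  A^T *m A = B^T *m B -> 1 <= c -> frob_sq (A *m B^T) <= c ->
  (mx_box m r c `*` mx_box n r c) (A, B).
Proof.
move=> AB c1 Wc.
(* If [|x| > c >= 1], then [x^4 > |x| > c]. *)
have quart (x : R) : (x ^+ 2) ^+ 2 <= c -> `|x| <= c.
  rewrite -(@real_normK _ x) ?num_real//; have := normr_ge0 x.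
  by move: (`|x|) => y y0 yc; rewrite leNgt; apply/negP => cy;
    have : 1 < y ^+ 2; [nra | have : y < y ^+ 2; nra].
split=> i j /=; apply: quart; apply: le_trans Wc; first exact: balanced_entry_le.
by rewrite -frob_sq_trmx trmx_mul trmxK; exact: balanced_entry_le.
Qed.

(** * Rotation invariance and comparison of local minima *)

Lemma frob_sq_continuous {R : realType} {m n : nat} :
  continuous (@frob_sq R m n).
Proof.
by move=> M; exact: (@cvg_frob_sq _ (nbhs M) (nbhs_filter M) _ _ _ id M cvg_id).
Qed.

Lemma continuous_mulmxr_pair {R : realType} {m n r : nat} (Q : 'M[R]_r) :
  continuous (fun P : 'M[R]_(m, r) * 'M[R]_(n, r) => (P.1 *m Q, P.2 *m Q)).
Proof.
move=> P; apply: (cvg_pair (G := nbhs (P.1 *m Q)) (H := nbhs (P.2 *m Q)));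
  apply: (@cvg_mulmx _ (nbhs P)); try exact: cvg_cst.
  exact: cvg_fst.
exact: cvg_snd.
Qed.

Lemma frob_sq_mul_orthogonal {R : realType} {p q : nat}
  (A : 'M[R]_(p, q)) (Q : 'M[R]_q) :
  Q *m Q^T = 1%:M -> frob_sq (A *m Q) = frob_sq A.
Proof.
by move=> QQ; rewrite !frob_sq_tr trmx_mul mulmxA -(mulmxA A) QQ mulmx1.
Qed.

Lemma loss_L2_mul_orthogonal {R : realType} {m n r : nat}
  (L : 'M[R]_(m, n) -> R) (lambda : R) (P : 'M[R]_(m, r) * 'M[R]_(n, r)) (Q : 'M[R]_r) :
  Q *m Q^T = 1%:M -> loss_L2 L lambda (P.1 *m Q, P.2 *m Q) = loss_L2 L lambda P.
Proof.
move=> QQ; rewrite /loss_L2/= !frob_sq_mul_orthogonal//.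
by rewrite trmx_mul mulmxA -(mulmxA P.1) QQ mulmx1.
Qed.

Lemma loss_L2_balanced {R : realType} {m n r : nat}
  (L : 'M[R]_(m, n) -> R) (lambda : R)
  (A : 'M[R]_(m, r)) (B : 'M[R]_(n, r)) :
  A^T *m A = B^T *m B ->
  loss_L2 L lambda (A, B) = loss_nuc L lambda (A *m B^T).
Proof.
by move=> AB; rewrite /loss_L2 /loss_nuc/= nuclear_norm_balanced//; field.
Qed.

Lemma loss_nuc_le_L2 {R : realType} {m n r : nat}
  (L : 'M[R]_(m, n) -> R) (lambda : R) (P : 'M[R]_(m, r) * 'M[R]_(n, r)) :
  0 <= lambda -> loss_nuc L lambda (P.1 *m P.2^T) <= loss_L2 L lambda P.
Proof.
move=> l0; rewrite /loss_nuc /loss_L2 lerD2l -mulrA ler_wpM2l// mulrC.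
exact: nuclear_norm_le.
Qed.

(** The curve of [(A *m stretch v c, B *m stretch v c^-1)] passes through [(A, B)] at [c = 1] and
    keeps the [L] term constant, so minimality along it concerns the Frobenius cost alone. *)
Lemma local_min_L2_balanced {R : realType} {m n r : nat}
  (L : 'M[R]_(m, n) -> R) (lambda : R) (A : 'M[R]_(m, r)) (B : 'M[R]_(n, r)) :
  0 < lambda -> local_min (loss_L2 L lambda) (A, B) -> A^T *m A = B^T *m B.
Proof.
move=> l0 [_ minAB]; apply: balanced_of_stretch => v.
have cs (f : R -> R) : f c @[c --> (1 : R)] --> (1 : R) ->
    stretch v (f c) @[c --> (1 : R)] --> stretch v 1.
  move=> f1; apply: (@cvg_mx _ (nbhs (1 : R))) => i j.
  rewrite !mxE; under eq_cvg do rewrite !mxE.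
  apply: cvgD; first exact: cvg_cst.
  apply: cvgM; last exact: cvg_cst.
  apply: cvgM; last exact: cvg_cst.
  by apply: cvgB => //; exact: cvg_cst.
have pair : (A *m stretch v c, B *m stretch v c^-1) @[c --> (1 : R)] --> (A, B).
  rewrite -{2}(mulmx1 A) -{2}(mulmx1 B) -(stretch1 v).
  apply: (cvg_pair (G := nbhs (A *m stretch v 1)) (H := nbhs (B *m stretch v 1)));
    (apply: cvg_mulmx; first exact: cvg_cst); apply: cs => //.
  by rewrite -[X in _ --> X]invr1; apply: cvgV => //; exact: oner_neq0.
have near1 : \forall c \near (1 : R),
    loss_L2 L lambda (A, B) <= loss_L2 L lambda (A *m stretch v c, B *m stretch v c^-1).
  have := pair _ minAB; apply: (@filterS _ _ (nbhs_filter (1 : R))).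
  by move=> c /(_ I).
apply: filterS2 (lt_nbhsr (ltr01 : 0 < 1 :> R)) near1 => c c0.
rewrite /loss_L2/= trmx_mul stretch_tr mulmxA -(mulmxA A) stretchM divff ?gt_eqF//.
by rewrite stretch1 mulmx1 lerD2l ler_pM2l// divr_gt0.
Qed.

(* Balanced factors of matrices near [A *m B^T] are close to [(A, B)] up to a
   common rotation: those that are not form a compact set, whose closed image
   under [(A', B') |-> A' *m B'^T] misses [A *m B^T]. *)
Lemma near_balanced_factor {R : realType} {m n r : nat}
  (A : 'M[R]_(m, r)) (B : 'M[R]_(n, r)) (U : set ('M[R]_(m, r) * 'M[R]_(n, r))) :
  A^T *m A = B^T *m B -> nbhs (A, B) U ->
  \forall W \near A *m B^T, forall A' B', A'^T *m A' = B'^T *m B' ->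
    A' *m B'^T = W ->
    exists2 Q : 'M[R]_r, Q *m Q^T = 1%:M & U (A' *m Q, B' *m Q).
Proof.
move=> AB UAB.
(* [O] collects the pairs that some rotation carries into the interior of [U]. *)
pose O := \bigcup_(Q in [set Q : 'M[R]_r | Q *m Q^T = 1%:M])
  ((fun P : 'M[R]_(m, r) * 'M[R]_(n, r) => (P.1 *m Q, P.2 *m Q)) @^-1` U°).
have oO : open O.
  apply: bigcup_open => Q _; apply: open_comp; last exact: open_interior.
  by move=> P _; exact: continuous_mulmxr_pair.
(* The [+ 1] makes [frob_sq W < c] hold near [A *m B^T] and gives [1 <= c] for [balanced_mx_box]. *)
pose c := frob_sq (A *m B^T) + 1.
pose bal := [set P : 'M[R]_(m, r) * 'M[R]_(n, r) | P.1^T *m P.1 - P.2^T *m P.2 = 0].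
pose K := (mx_box m r c `*` mx_box n r c) `&` bal `&` ~` O.
have cK : compact K.
  apply: compact_closedI; last exact: open_closedC.
  apply: compact_closedI; first exact: mx_box_pair_compact.
  apply: closed_mx_eq => P; apply: cvgB; apply: cvg_mulmx;
    by [exact: cvg_fst|exact: cvg_snd|apply: cvg_trmx; exact: cvg_fst|
        apply: cvg_trmx; exact: cvg_snd].
pose f (P : 'M[R]_(m, r) * 'M[R]_(n, r)) := P.1 *m P.2^T.
have cfK : closed (f @` K).
  apply: compact_closed; first exact: norm_hausdorff.
  apply: continuous_compact cK; apply: continuous_subspaceT; exact: continuous_mul_tr.
have nfK : (~` (f @` K)) (A *m B^T).
  move=> [[A' B'] [[_ bal'] nO] fP]; apply: nO; rewrite /f/= in fP.
  have AB' : A'^T *m A' = B'^T *m B' by apply/eqP; rewrite -subr_eq0; apply/eqP.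
  have [Q QQ [AQ BQ]] := balanced_factor_orthogonal _ _ _ _ AB' AB fP.
  by exists Q => //=; rewrite -AQ -BQ.
have : \forall W \near A *m B^T, frob_sq W < c.
  have cW := @frob_sq_continuous R m n (A *m B^T).
  have ltc : frob_sq (A *m B^T) < c by rewrite /c ltrDl.
  exact: cvgr_lt _ cW _ ltc.
apply: filterS2 (open_nbhs_nbhs (conj (closed_openC cfK) nfK)) => W nW Wc A' B' AB' fW.
have [[Q QQ UQ]|nO] := pselect (O (A', B')).
  by exists Q => //; exact: interior_subset UQ.
exfalso; apply: nW; exists (A', B') => //; split=> //; split.
  by apply: balanced_mx_box => //; [rewrite /c lerDr frob_sq_ge0|rewrite fW ltW].
by rewrite /bal/= AB' subrr.
Qed.

Theorem theorem1 (R : realType) (m n r : nat)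
  (hr1 : (1 <= r)%N) (hrm : (r <= m)%N) (hrn : (r <= n)%N)
  (L : 'M[R]_(m, n) -> R) (hL : forall W, differentiable L W)
  (lambda : R) (hlam : 0 < lambda)
  (A : 'M[R]_(m, r)) (B : 'M[R]_(n, r)) :
  local_min (loss_L2 L lambda) (A, B) <->
  (local_min_on (loss_nuc L lambda) (@rank_le R m n r) (A *m B^T) /\
   A^T *m A = B^T *m B).
Proof.
have l0 := ltW hlam; split=> [minAB|[[_ minW] AB]].
  have AB := local_min_L2_balanced _ _ _ _ hlam minAB.
  split=> //; split; first exact: mulmx_max_rank.
  apply: filterS (near_balanced_factor _ _ _ AB minAB.2) => W nearW Wr.
  (* A cheapest factorization of [W] is balanced, so a rotation moves it to where [(A, B)] is
     minimal; [loss_L2] is unchanged and equals [loss_nuc] at both balanced pairs. *)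
  have [A' [B' [AB'W minAB']]] := exists_min_factor W Wr.
  have AB' : A'^T *m A' = B'^T *m B'.
    by apply: balanced_of_min_factor => A1 B1; rewrite AB'W; exact: minAB'.
  have [Q QQ /(_ I)] := nearW _ _ AB' AB'W.
  by rewrite (loss_L2_mul_orthogonal _ _ (A', B'))// !loss_L2_balanced// AB'W.
(* For [P] near [(A, B)] with product [W'], the chain is [loss_L2 (A, B) = loss_nuc (A *m B^T) <=
   loss_nuc W' <= loss_L2 P]. *)
split=> //; have := continuous_mul_tr (A, B) _ minW.
apply: (@filterS _ _ (nbhs_filter (A, B))) => P minP _; rewrite loss_L2_balanced//.
by apply: le_trans (loss_nuc_le_L2 _ _ _ l0); apply: minP; exact: mulmx_max_rank.
Qed.
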